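(* Let $(X,d)$ be a non-compact metric space and let $f:X\to\mathbb{R}$ be bounded and continuous. Let $p:X\times\mathbb{R}\to\mathbb{R}$ be a Birkhoff-James extension of $f$, and let $g(t)=\sup_{x\in X}p(x,t)$ for all $t\in\mathbb{R}$. Then: (i) There exist a maximizing sequence $\{x_n\}$ of $f$ and a sequence of positive reals $t_n\to 0$ such that both sequences $p_{t+}(x_n,t_n)$ and $p_{t-}(x_n,t_n)$ converge to $g'(0+)$, and $g'(0+)\ge 0$. (ii) There exist a maximizing sequence $\{y_n\}$ of $f$ and a sequence of negative reals $s_n\to 0$ such that both sequences $p_{t+}(y_n,s_n)$ and $p_{t-}(y_n,s_n)$ converge to $g'(0-)$, and $g'(0-)\le 0$.
   Context: Let $(X,d)$ be a non-compact metric space and $f:X\to\mathbb{R}$ a bounded continuous function. Convex extension (non-compact case): a continuous map $p:X\times\mathbb{R}\to\mathbb{R}$ is a convex extension of $f$ if (i) for each $t\in\mathbb{R}$, $x\mapsto p(x,t)$ is a bounded function on $X$; (ii) for each $x\in X$, $p(x,0)=f(x)$ and $t\mapsto p(x,t)$ is a convex function on $\mathbb{R}$; (iii) there exists a continuous map $h:\mathbb{R}\to\mathbb{R}$ such that $h(0)=0$ and $|p(x,t)-p(x,s)|\le|h(t)-h(s)|$ for all $x\in X$ and $t,s\in\mathbb{R}$. Birkhoff-James extension: a convex extension $p$ of $f$ is a Birkhoff-James extension of $f$ if $g(t)\ge g(0)$ for all $t\in\mathbb{R}$, where $g(t)=\sup_{x\in X}p(x,t)$ (a convex function on $\mathbb{R}$).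 Maximizing sequence: a sequence $\{x_n\}$ in $X$ is a maximizing sequence for $f$ if $f(x_n)\to\sup_{x\in X}f(x)$. Notation: $p_{t+}(x_0,t_0)$ and $p_{t-}(x_0,t_0)$ denote the right and left derivatives at $t_0$ of $t\mapsto p(x_0,t)$; $g'(0+)$ and $g'(0-)$ denote the right and left derivatives of $g$ at $0$. *)

(* Defs.v *)
From mathcomp Require Import all_boot all_order all_algebra.
From mathcomp Require Import all_classical all_reals all_analysis.
From mathcomp Require Import ring lra.

Set Implicit Arguments.
Unset Strict Implicit.
Unset Printing Implicit Defensive.

Import Order.TTheory GRing.Theory Num.Theory.
Import numFieldNormedType.Exports.

Local Open Scope classical_set_scope.
Local Open Scope ring_scope.

Definition right_derivative (R : realType) (u : R -> R) (t : R) : R :=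
  lim ((u (t + h) - u t) / h @[h --> 0^'+]).

Definition left_derivative (R : realType) (u : R -> R) (t : R) : R :=
  lim ((u (t + h) - u t) / h @[h --> 0^'-]).

Definition sup_extension (R : realType) (X : Type) (p : X * R -> R) (t : R) : R :=
  sup (range (fun x => p (x, t))).

Record convex_extension (R : realType) (X : metricType R)
    (f : X -> R) (p : X * R -> R) : Prop := {
  cext_continuous : continuous p ;
  cext_bounded : forall t, bounded_fun (fun x => p (x, t)) ;
  cext_at0 : forall x, p (x, 0) = f x ;
  cext_convex : forall x, convex_function [set: R^o] (fun t : R^o => p (x, t)) ;
  cext_modulus : exists h : R -> R, [/\ continuous h, h 0 = 0 &
    forall x t s, `|p (x, t) - p (x, s)| <= `|h t - h s|] }.

Definition birkhoff_james_extension (R : realType) (X : metricType R)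
    (f : X -> R) (p : X * R -> R) : Prop :=
  convex_extension f p /\ forall t, sup_extension p 0 <= sup_extension p t.

Definition maximizing_sequence (R : realType) (X : Type)
    (f : X -> R) (x : nat -> X) : Prop :=
  f (x n) @[n --> \oo] --> sup (range f).

(* The two limits above are total; they are genuine limits for convex functions,
   hence for p (x, -) and, by sup_extension_convex, for sup_extension p. *)
Section convex_one_sided.
Variable R : realType.
Implicit Types (u : R -> R) (a b h k t : R).

Lemma convex_functionRP u : convex_function [set: R^o] (u : R^o -> R^o) <->
  forall a b t, 0 <= t -> t <= 1 ->
    u (t * a + (1 - t) * b) <= t * u a + (1 - t) * u b.
Proof.
split=> [cu a b t t0 t1|cu t a b _ _].
  by have := cu (Itv01 t0 t1) a b (in_setT _) (in_setT _).
by apply: (cu a b t%:num).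
Qed.

Lemma convex_chord u a b k : convex_function [set: R^o] (u : R^o -> R^o) ->
  a < b -> b < k -> (k - a) * u b <= (k - b) * u a + (b - a) * u k.
Proof.
move=> /convex_functionRP cu ab bk.
have ka : 0 < k - a by lra.
have t0 : 0 <= (k - b) / (k - a) by apply: divr_ge0; lra.
have t1 : (k - b) / (k - a) <= 1 by rewrite ler_pdivrMr//; lra.
have := cu a k _ t0 t1.
have -> : (k - b) / (k - a) * a + (1 - (k - b) / (k - a)) * k = b.
  by field; lra.
rewrite -(ler_pM2l ka); congr (_ <= _).
by field; lra.
Qed.

Lemma convex_slope_le u t h k :
  convex_function [set: R^o] (u : R^o -> R^o) -> h != 0 -> k != 0 -> h <= k ->
  (u (t + h) - u t) / h <= (u (t + k) - u t) / k.
Proof.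
move=> cu h0 k0; rewrite le_eqVlt => /predU1P[->//|hk].
have [h_gt0|h_lt0|/eqP] := ltgtP 0 h; last by rewrite eq_sym (negbTE h0).
- have k_gt0 : 0 < k by exact: lt_trans hk.
  have := @convex_chord u t (t + h) (t + k) cu ltac:(lra) ltac:(lra).
  rewrite ler_pdivrMr// mulrAC ler_pdivlMr//; nra.
- have [k_gt0|k_lt0|/eqP] := ltgtP 0 k; last by rewrite eq_sym (negbTE k0).
  + have := @convex_chord u (t + h) t (t + k) cu ltac:(lra) ltac:(lra).
    rewrite ler_ndivrMr// mulrAC ler_pdivrMr//; nra.
  + have := @convex_chord u (t + h) (t + k) t cu ltac:(lra) ltac:(lra).
    rewrite ler_ndivrMr// mulrAC ler_ndivrMr//; nra.
Qed.

Lemma is_cvg_right_derivative u t :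
  convex_function [set: R^o] (u : R^o -> R^o) ->
  cvg ((u (t + h) - u t) / h @[h --> 0^'+]).
Proof.
move=> cu; apply: nondecreasing_at_right_is_cvgr.
  near=> e => x y; rewrite !in_itv/= => /andP[x0 _] /andP[y0 _] xy.
  by apply: convex_slope_le => //; rewrite gt_eqF.
near=> e; exists ((u (t + -1) - u t) / -1) => _ [x /= + <-].
rewrite in_itv/= => /andP[x0 _].
apply: convex_slope_le; [by []|by rewrite lt_eqF ?ltrN10|by rewrite gt_eqF|lra].
Unshelve. all: by end_near. Qed.

Lemma is_cvg_left_derivative u t :
  convex_function [set: R^o] (u : R^o -> R^o) ->
  cvg ((u (t + h) - u t) / h @[h --> 0^'-]).
Proof.
move=> cu; apply: nondecreasing_at_left_is_cvgr.
  near=> e => x y; rewrite !in_itv/= => /andP[_ x0] /andP[_ y0] xy.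
  by apply: convex_slope_le => //; rewrite lt_eqF.
near=> e; exists ((u (t + 1) - u t) / 1) => _ [x /= + <-].
rewrite in_itv/= => /andP[_ x0].
apply: convex_slope_le; [by []|by rewrite lt_eqF|by rewrite oner_eq0|lra].
Unshelve. all: by end_near. Qed.

End convex_one_sided.

Lemma sup_extension_convex (R : realType) (X : metricType R)
    (f : X -> R) (p : X * R -> R) : [set: X] !=set0 -> convex_extension f p ->
  convex_function [set: R^o] (sup_extension p : R^o -> R^o).
Proof.
move=> [x0 _] pE; apply/convex_functionRP => a b t t0 t1.
have ub r x : p (x, r) <= sup_extension p r.
  apply: ub_le_sup; last by exists x.
  exact: bounded_fun_has_ubound (cext_bounded pE r).
apply: ge_sup; first by exists (p (x0, t * a + (1 - t) * b)); exists x0.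
move=> _ [x _ <-].
have /convex_functionRP/(_ a b t t0 t1) := cext_convex pE x.
move/le_trans; apply; apply: lerD; apply: ler_wpM2l; rewrite ?ub//; lra.
Qed.

(* Main.v *)
Require Import Defs.
From mathcomp Require Import all_boot all_order all_algebra.
From mathcomp Require Import all_classical all_reals all_analysis.
From mathcomp Require Import ring lra.

Import Order.TTheory GRing.Theory Num.Theory.
Import numFieldNormedType.Exports.

Local Open Scope classical_set_scope.
Local Open Scope ring_scope.

(** For a convex function the slope of a chord from a fixed point grows with the increment, so
    one-sided derivatives are bounded by slopes of chords. Put a = g'(0+). For small t the slopes of
    g on [0, t] and [0, 2t] are both close to a. If x nearly attains the supremum g(t), with an
    error small relative to t, then p(x, -) climbs almost as much as g on [0, t] and hardly more
    than g on [t, 2t]. Its left and right derivatives at t lie between these two slopes, hence near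
    a ([near_right_derivative_sup_extension]). The modulus h gives p(x, t) close to f(x), uniformly
    in x, while g(t) >= g(0) = sup f; so x nearly maximizes f. Errors 1/(n + 1) yield the sequences
    of (i). Part (ii) is (i) for the reflected extension p(x, -t), which exchanges the two one-sided
    derivatives and changes their sign. *)

Lemma right_derivative_le_slope {R : realType} {u : R -> R} (t h : R) :
  convex_function [set: R^o] (u : R^o -> R^o) -> 0 < h ->
  right_derivative u t <= (u (t + h) - u t) / h.
Proof.
move=> cu h0; apply: limr_le; first exact: is_cvg_right_derivative.
near=> k; have k0 : 0 < k by [].
by apply: convex_slope_le; rewrite ?gt_eqF//; near: k; exact: nbhs_right_le.
Unshelve. all: by end_near. Qed.

Lemma slope_le_right_derivative {R : realType} {u : R -> R} (t h : R) :
  convex_function [set: R^o] (u : R^o -> R^o) -> h < 0 ->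
  (u (t + h) - u t) / h <= right_derivative u t.
Proof.
move=> cu h0; apply: limr_ge; first exact: is_cvg_right_derivative.
near=> k; have k0 : 0 < k by [].
by apply: convex_slope_le; rewrite ?(lt_eqF h0) ?(gt_eqF k0)//; lra.
Unshelve. all: by end_near. Qed.

Lemma slope_le_left_derivative {R : realType} {u : R -> R} (t h : R) :
  convex_function [set: R^o] (u : R^o -> R^o) -> h < 0 ->
  (u (t + h) - u t) / h <= left_derivative u t.
Proof.
move=> cu h0; apply: limr_ge; first exact: is_cvg_left_derivative.
near=> k; have k0 : k < 0 by [].
by apply: convex_slope_le; rewrite ?lt_eqF//; near: k; exact: nbhs_left_ge.
Unshelve. all: by end_near. Qed.

Lemma left_le_right_derivative {R : realType} {u : R -> R} (t : R) :
  convex_function [set: R^o] (u : R^o -> R^o) ->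
  left_derivative u t <= right_derivative u t.
Proof.
move=> cu; apply: limr_le; first exact: is_cvg_left_derivative.
by near=> k; apply: slope_le_right_derivative.
Unshelve. all: by end_near. Qed.

Lemma convex_functionN {R : realType} {u : R -> R} :
  convex_function [set: R^o] (u : R^o -> R^o) ->
  convex_function [set: R^o] ((fun r => u (- r)) : R^o -> R^o).
Proof.
move=> /convex_functionRP cu; apply/convex_functionRP => a b t t0 t1.
have -> : - (t * a + (1 - t) * b) = t * - a + (1 - t) * - b by ring.
exact: cu.
Qed.

Lemma right_derivativeN {R : realType} {u : R -> R} (t : R) :
  convex_function [set: R^o] (u : R^o -> R^o) ->
  right_derivative (fun r => u (- r)) t = - left_derivative u (- t).
Proof.
move=> cu; apply/cvg_lim => //; apply/cvg_at_rightNP; rewrite oppr0.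
rewrite (_ : _ \o _ = fun h => - ((u (- t + h) - u (- t)) / h)).
  by apply: cvgN; exact: is_cvg_left_derivative.
by apply: funext => h /=; rewrite opprD opprK invrN mulrN.
Qed.

Lemma left_derivativeN {R : realType} {u : R -> R} (t : R) :
  convex_function [set: R^o] (u : R^o -> R^o) ->
  left_derivative (fun r => u (- r)) t = - right_derivative u (- t).
Proof.
move=> cu; have := right_derivativeN (- t) (convex_functionN cu).
rewrite opprK (_ : (fun r => u (- - r)) = u) => [->|]; first by rewrite opprK.
by apply: funext => r; rewrite opprK.
Qed.

(** Reduces (ii) to (i): minimality of [sup_extension p] at 0 is symmetric in t, and h(-t) serves as
    the new modulus. *)
Lemma birkhoff_james_extensionN {R : realType} {X : metricType R} {f : X -> R}
    {p : X * R -> R} : birkhoff_james_extension f p ->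
  birkhoff_james_extension f (fun z => p (z.1, - z.2)).
Proof.
move=> [pE gmin]; split; last first.
  by move=> t; rewrite {1}/sup_extension /= oppr0; exact: (gmin (- t)).
have [h [ch h0 hp]] := cext_modulus pE; split => /=.
- move=> z; apply: (@continuous_comp _ _ _ (fun z => (z.1, - z.2)) p).
    apply: (@cvg_pair _ _ _ _ (nbhs z.1) (nbhs (- z.2))); first exact: cvg_fst.
    by apply: cvgN; exact: cvg_snd.
  exact: (cext_continuous pE).
- by move=> t; exact: (cext_bounded pE).
- by move=> x; rewrite oppr0; exact: (cext_at0 pE).
- by move=> x; exact: (convex_functionN (cext_convex pE x)).
- exists (fun t => h (- t)); split; rewrite ?oppr0// => t.
  by apply: continuous_comp; [exact: opp_continuous|exact: ch].
Qed.

Lemma cvg_dist_harmonic (R : realType) (u : nat -> R) (l : R) :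
  (forall n, `|u n - l| <= harmonic n) -> u n @[n --> \oo] --> l.
Proof.
move=> ul; apply/cvgrPdist_le => e e0.
near=> n; rewrite distrC (le_trans (ul n))//; near: n.
have /cvgrPdist_le/(_ e e0) := @cvg_harmonic R.
by apply: filterS => n; rewrite sub0r normrN; apply: le_trans; exact: ler_norm.
Unshelve. all: by end_near. Qed.

Section birkhoff_james.
Context {R : realType} {X : metricType R} {f : X -> R} {p : X * R -> R}.
Hypotheses (X0 : [set: X] !=set0) (pBJ : birkhoff_james_extension f p).
Let g := sup_extension p.

Lemma ger_right_derivative_sup_extension : 0 <= right_derivative g 0.
Proof.
have [pE gmin] := pBJ.
apply: limr_ge.
  exact: (is_cvg_right_derivative (sup_extension_convex X0 pE)).
(* Since g is minimal at 0, each difference quotient with h > 0 is nonnegative. *)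
near=> h; have h0 : 0 < h by [].
by rewrite add0r divr_ge0 ?subr_ge0 ?gmin// ltW.
Unshelve. all: by end_near. Qed.

(* Take t so small that the slope of g on [0, 2t] is within e / 4 of g'(0+), and
   x with p(x, t) > g(t) - e t / 4. As p(x, 0) <= g(0) and p(x, 2t) <= g(2t),
   the slopes of p(x, -) on [0, t] and [t, 2t] trap both derivatives at t. *)
Lemma near_right_derivative_sup_extension (e : R) : 0 < e ->
  exists z : X * R, [/\ 0 < z.2 <= e, `|f z.1 - sup (range f)| <= e,
    `|right_derivative (fun r => p (z.1, r)) z.2 - right_derivative g 0| <= e &
    `|left_derivative (fun r => p (z.1, r)) z.2 - right_derivative g 0| <= e].
Proof.
move=> e0; have [pE gmin] := pBJ; have [h [ch h0 hp]] := cext_modulus pE.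
have gconv := sup_extension_convex X0 pE.
have e4 : 0 < e / 4 by lra.
have e2 : 0 < e / 2 by lra.
set a := right_derivative g 0.
have ub r x : p (x, r) <= g r.
  apply: ub_le_sup; last by exists x.
  exact: bounded_fun_has_ubound (cext_bounded pE r).
have gf : g 0 = sup (range f).
  rewrite (_ : f = fun x => p (x, 0))//.
  by apply: funext => x; rewrite (cext_at0 pE).
(* The bound on h t keeps p(x, t) near f x for every x at once; t <= 1 turns the error e t / 4 into
   at most e / 4. *)
have [t [t0 te t1 ht gt2]] : exists t,
    [/\ 0 < t, t <= e, t <= 1, `|h t| <= e / 2 & (g (2 * t) - g 0) / (2 * t) <= a + e / 4].
  have /cvgrPdist_le/(_ _ e4) : (g (0 + k) - g 0) / k @[k --> 0^'+] --> a.
    exact: (is_cvg_right_derivative (t := 0) gconv).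
  move=> slope_near.
  have [k [k0]] : exists k, 0 < k /\ `|a - (g (0 + k) - g 0) / k| <= e / 4.
    by near (0 : R)^'+ => k; exists k; split; [|near: k].
  rewrite ler_norml => /andP[gk _].
  have k2 : 0 < k / 2 by lra.
  have h_near : \forall t \near 0^'+, `|h t| <= e / 2.
    have /cvgrPdist_le/(_ _ e2) := cvg_at_right_filter (ch 0).
    by apply: filterS => t; rewrite h0 sub0r normrN.
  near (0 : R)^'+ => t; exists t.
  have t0 : 0 < t by [].
  (* Then 2t <= k, and the slope bound at k passes to 2t by monotonicity of slopes. *)
  have tk : t <= k / 2 by near: t; exact: nbhs_right_le.
  split => //; [by near: t; exact: nbhs_right_le..|by near: t|].
  have := @convex_slope_le _ g 0 (2 * t) k gconv.
  rewrite !gt_eqF ?mulr_gt0// add0r => /(_ isT isT); lra.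
(* The error is proportional to t, so that it costs only e / 4 after division by t. *)
have [_ [x _ <-] /= xt] : exists2 y, range (fun x => p (x, t)) y &
    g t - e / 4 * t < y.
  apply: sup_adherent; first by rewrite mulr_gt0.
  split; last exact: bounded_fun_has_ubound (cext_bounded pE t).
  by have [x _] := X0; exists (p (x, t)); exists x.
have cx := cext_convex pE x.
have gt1 : a * t <= g t - g 0.
  rewrite -ler_pdivlMr//; have := right_derivative_le_slope 0 t gconv t0.
  by rewrite add0r.
have {}gt2 : g (2 * t) - g 0 <= (a + e / 4) * (2 * t).
  by rewrite -ler_pdivrMr//; lra.
have et : 0 < e * t by exact: mulr_gt0.
have fx0 := ub 0 x; have p0 := cext_at0 pE x.
have Lge : a - e / 4 <= left_derivative (fun r => p (x, r)) t.
  apply: (le_trans _ (slope_le_left_derivative t (- t) cx _)); last lra.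
  rewrite subrr invrN mulrN -mulNr ler_pdivlMr//; lra.
(* The rise of p(x, -) on [t, 2t] is at most 2t (a + e / 4) - a t + e t / 4, so its slope is at most
   a + 3 e / 4. *)
have Rle : right_derivative (fun r => p (x, r)) t <= a + e.
  apply: (le_trans (right_derivative_le_slope t t cx t0)).
  have := ub (2 * t) x; have -> : t + t = 2 * t by ring.
  rewrite ler_pdivrMr//; lra.
have LR := left_le_right_derivative t cx.
exists (x, t); split => /=; rewrite ?t0//; rewrite ler_norml; last 2 first.
- by apply/andP; split; lra.
- by apply/andP; split; lra.
(* f x >= p(x, t) - e / 2 >= g(t) - e / 4 - e / 2, and g(t) >= g(0) = sup f. *)
have := hp x t 0; rewrite h0 subr0 => /le_trans/(_ ht).
rewrite ler_norml => /andP[_].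
have := gmin t; rewrite -/g -gf => gt0.
have : e / 4 * t <= e / 4 by rewrite ger_pMr.
by move=> ? ?; apply/andP; split; lra.
Unshelve. all: by end_near. Qed.

Lemma birkhoff_james_right : exists (x : nat -> X) (t : nat -> R),
  [/\ maximizing_sequence f x, forall n, 0 < t n, t n @[n --> \oo] --> 0,
    right_derivative (fun r => p (x n, r)) (t n) @[n --> \oo]
      --> right_derivative g 0 &
    left_derivative (fun r => p (x n, r)) (t n) @[n --> \oo]
      --> right_derivative g 0].
Proof.
have [z zP] := choice (fun n => near_right_derivative_sup_extension _
  (@harmonic_gt0 R n)).
exists (fun n => (z n).1), (fun n => (z n).2); split.
- by apply: cvg_dist_harmonic => n; have [] := zP n.
- by move=> n; have [/andP[]] := zP n.
- apply: cvg_dist_harmonic => n; have [/andP[t0 tn] _ _ _] := zP n.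
  by rewrite subr0 gtr0_norm.
- by apply: cvg_dist_harmonic => n; have [] := zP n.
- by apply: cvg_dist_harmonic => n; have [] := zP n.
Qed.

End birkhoff_james.

Theorem theorem3p5 (R : realType) (X : metricType R) (f : X -> R) (p : X * R -> R) :
  ~ compact [set: X] ->
  bounded_fun f ->
  continuous f ->
  birkhoff_james_extension f p ->
  let g := sup_extension p in
  ((exists (x : nat -> X) (t : nat -> R),
      [/\ maximizing_sequence f x,
          forall n, 0 < t n,
          t n @[n --> \oo] --> 0,
          right_derivative (fun r => p (x n, r)) (t n) @[n --> \oo]
            --> right_derivative g 0 &
          left_derivative (fun r => p (x n, r)) (t n) @[n --> \oo]
            --> right_derivative g 0])
    /\ 0 <= right_derivative g 0) /\
  ((exists (y : nat -> X) (s : nat -> R),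
      [/\ maximizing_sequence f y,
          forall n, s n < 0,
          s n @[n --> \oo] --> 0,
          right_derivative (fun r => p (y n, r)) (s n) @[n --> \oo]
            --> left_derivative g 0 &
          left_derivative (fun r => p (y n, r)) (s n) @[n --> \oo]
            --> left_derivative g 0])
    /\ left_derivative g 0 <= 0).
Proof.
move=> ncX _ _ pBJ g.
(* The empty set is compact. A point of X makes the suprema defining g genuine. *)
have X0 : [set: X] !=set0.
  apply/set0P/negP => /eqP XE; apply: ncX; rewrite XE; exact: compact0.
have qBJ := birkhoff_james_extensionN pBJ.
have cp x := cext_convex (proj1 pBJ) x.
have gN : right_derivative (sup_extension (fun z => p (z.1, - z.2))) 0
    = - left_derivative g 0.
  rewrite -[in RHS]oppr0 -right_derivativeN//.
  exact: (sup_extension_convex X0 (proj1 pBJ)).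
split; split.
- exact: birkhoff_james_right.
- exact: (ger_right_derivative_sup_extension X0 pBJ).
- have [y [s [ymax s0 slim Rlim Llim]]] := birkhoff_james_right X0 qBJ.
  exists y, (fun n => - s n); split => //.
  + by move=> n; rewrite oppr_lt0.
  + by rewrite -[0]oppr0; exact: cvgN.
  (* The right derivative of p at -s n is minus the left derivative of the reflected function at s
     n. *)
  + rewrite -[left_derivative g 0]opprK -gN.
    rewrite (_ : (fun _ => _) = fun n =>
      - left_derivative (fun r => p (y n, - r)) (s n)); first exact: cvgN.
    by apply: funext => n; rewrite (left_derivativeN (u := fun r => p (y n, r)))// opprK.
  + rewrite -[left_derivative g 0]opprK -gN.
    rewrite (_ : (fun _ => _) = fun n =>
      - right_derivative (fun r => p (y n, - r)) (s n)); first exact: cvgN.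
    by apply: funext => n; rewrite (right_derivativeN (u := fun r => p (y n, r)))// opprK.
- by rewrite -oppr_ge0 -gN (ger_right_derivative_sup_extension X0 qBJ).
Qed.
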